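(* Let $n_U=|T\cup S|\ge2$ be fixed (a degree of freedom both driven and read is counted once) and suppose the bond count does not bind, so that the ceiling on the reachable dimension of a layout is $m_Tm_S-\tfrac12p(p-1)=(\alpha+p)(\gamma+p)-\tfrac12p(p-1)$ with $\alpha=m_T-p$, $\gamma=m_S-p$. Then for each integer $0\le p\le n_U$ this ceiling, maximised over integers $\alpha,\gamma\ge0$ with $\alpha+\gamma=n_U-p$, is $$\Lambda(p)=\Bigl\lfloor\tfrac14(n_U+p)^2\Bigr\rfloor-\tfrac12p(p-1),$$ which increases strictly with $p$ at every integer step $0\le p<n_U$, by $\Lambda(p+1)-\Lambda(p)=\lceil(n_U+p)/2\rceil-p\ge1$. The maximum is at full overlap $p=n_U$, $\Lambda(n_U)=n_U(n_U+1)/2$, against $\Lambda(0)=\lfloor n_U/2\rfloor\lceil n_U/2\rceil$ for the disjoint layout, a factor $\Lambda(n_U)/\Lambda(0)=2+1/\lfloor n_U/2\rfloor$, approaching two from above as $n_U\to\infty$.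
   Context: $S$ and $T$ are the finite sets of driven and read-out degrees of freedom of a network, $|S|=m_S$, $|T|=m_T$, $p=|T\cap S|$ is the overlap, and $n_U=|T\cup S|=\alpha+\gamma+p$. The general ceiling on the rank of the map from the $n_b$ bond stiffnesses to the response block $C[T,S]$ of a reciprocal network is $\min(n_b,\ m_Tm_S-\tfrac12p(p-1))$; ''the bond count does not bind'' means that the second argument is the minimum. *)

(* Defs.v *)
From HB Require Import structures.
From mathcomp Require Import all_boot all_order all_algebra.
From mathcomp Require Import all_classical all_reals all_analysis.
Set Implicit Arguments.
Unset Strict Implicit.
Unset Printing Implicit Defensive.
Import Order.TTheory GRing.Theory Num.Theory numFieldNormedType.Exports.
Local Open Scope classical_set_scope.
Local Open Scope ring_scope.

(* The number m_T m_S of entries of the response block C[T,S], minus the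
   p(p-1)/2 coincidences C_ij = C_ji, i <> j, that reciprocity forces on the
   p degrees of freedom both driven and read.  Everything is computed in R, so
   that neither the subtraction nor the halving truncates. *)
Definition reciprocal_entries (R : realType) (mT mS p : nat) : R :=
  mT%:R * mS%:R - p%:R * (p%:R - 1) / 2.

Definition rank_ceiling (R : realType) (nb mT mS p : nat) : R :=
  Num.min nb%:R (reciprocal_entries R mT mS p).

Definition bonds_do_not_bind (R : realType) (nb mT mS p : nat) : Prop :=
  reciprocal_entries R mT mS p <= nb%:R.

Definition is_maximum (R : realType) (A : set R) (m : R) : Prop :=
  A m /\ ubound A m.

Definition Lambda (R : realType) (nU p : nat) : R :=
  (Num.floor ((nU + p)%:R ^+ 2 / 4 : R))%:~R - p%:R * (p%:R - 1) / 2.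

(* Main.v *)
(* Write N = n_U + p.  Since m_T + m_S = N, the product m_T m_S is largest when
   the two factors are the two halves of N, with value floor(N/2) ceil(N/2) =
   floor(N^2/4); p <= n_U makes both halves at least p, so this split is
   realised by some alpha, gamma >= 0.  One more overlap unit enlarges the smaller half
   by one, hence the increment ceil(N/2) - p. *)
Require Import Defs.
From HB Require Import structures.
From mathcomp Require Import all_boot all_order all_algebra.
From mathcomp Require Import all_classical all_reals all_analysis.
From mathcomp Require Import zify ring lra.
Set Implicit Arguments.
Unset Strict Implicit.
Unset Printing Implicit Defensive.
Import Order.TTheory GRing.Theory Num.Theory numFieldNormedType.Exports.
Local Open Scope classical_set_scope.
Local Open Scope ring_scope.

Lemma half_add_uphalf (n : nat) : (n./2 + uphalf n = n)%N.
Proof. by rewrite uphalf_half addnCA addnn odd_double_half. Qed.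

(** AM-GM gives [4xy <= n^2]. With [h = n./2] this is [xy <= h^2] for even [n] and
    [xy <= h(h+1) + 1/4] for odd [n], where integrality removes the quarter. *)
Lemma leq_mul_halves (x y n : nat) :
  (x + y = n)%N -> (x * y <= n./2 * uphalf n)%N.
Proof.
move=> xy; have [le4 _] := nat_AGM2 x y; move: le4.
rewrite xy -{1}(half_add_uphalf n) uphalf_half expnS expn1.
by case: odd; move: (n./2) (x * y)%N => h m /=; nia.
Qed.

(** With the parity bit split off, a case on [odd n] turns rounding goals into polynomial ones in
    [n./2]. *)
Lemma natr_half (R : realType) (n : nat) :
  n%:R = (odd n)%:R + 2 * n./2%:R :> R.
Proof. by rewrite -[in LHS](odd_double_half n) natrD -mul2n natrM. Qed.

Lemma floor_half (R : realType) (n : nat) :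
  Num.floor (n%:R / 2 : R) = n./2%:Z.
Proof.
apply: floor_def; rewrite intrD -!pmulrn (natr_half _ n).
by case: odd => /=; apply/andP; split; lra.
Qed.

Lemma ceil_half (R : realType) (n : nat) :
  Num.ceil (n%:R / 2 : R) = (uphalf n)%:Z.
Proof.
apply: ceil_def; rewrite intrD -!pmulrn uphalf_half natrD (natr_half _ n).
by case: odd => /=; apply/andP; split; lra.
Qed.

Lemma floor_sqr_quarter (R : realType) (n : nat) :
  Num.floor (n%:R ^+ 2 / 4 : R) = (n./2 * uphalf n)%N%:Z.
Proof.
apply: floor_def; rewrite intrD -!pmulrn uphalf_half natrM natrD (natr_half _ n).
by case: odd => /=; apply/andP; split; nra.
Qed.

Lemma LambdaE (R : realType) (n p : nat) :
  Lambda R n p =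
  (n + p)./2%:R * (uphalf (n + p))%:R - p%:R * (p%:R - 1) / 2.
Proof. by rewrite /Lambda floor_sqr_quarter -pmulrn natrM. Qed.

Lemma rank_ceiling_unbound (R : realType) (nb mT mS p : nat) :
  bonds_do_not_bind R nb mT mS p ->
  rank_ceiling R nb mT mS p = mT%:R * mS%:R - p%:R * (p%:R - 1) / 2.
Proof. by move=> /min_idPr. Qed.

Lemma Lambda_is_maximum (R : realType) (nb n p : nat) : (p <= n)%N ->
  (forall alpha gamma : nat, (alpha + gamma + p = n)%N ->
     bonds_do_not_bind R nb (alpha + p) (gamma + p) p) ->
  is_maximum
    [set c : R | exists alpha gamma : nat,
       (alpha + gamma = n - p)%N /\
       c = rank_ceiling R nb (alpha + p) (gamma + p) p]
    (Lambda R n p).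
Proof.
move=> le_pn nbP; split=> /=.
  have hu := half_add_uphalf (n + p); have u := uphalf_half (n + p).
  exists ((n + p)./2 - p)%N, (uphalf (n + p) - p)%N; split; first by lia.
  rewrite rank_ceiling_unbound; last by apply: nbP; lia.
  by rewrite LambdaE !subnK //; lia.
move=> _ [a [g [ag ->]]].
rewrite rank_ceiling_unbound; last by apply: nbP; lia.
(* The reciprocity term depends on [p] alone, so only the products compete. *)
by rewrite LambdaE lerD2r -!natrM ler_nat leq_mul_halves //; lia.
Qed.

Lemma Lambda_step (R : realType) (n p : nat) :
  Lambda R n p.+1 - Lambda R n p = (uphalf (n + p))%:R - p%:R.
Proof.
(* From [N = n + p] to [N + 1] the old upper half becomes the lower one, and the old lower half plus
   one becomes the upper one. *)
rewrite !LambdaE addnS -uphalfE /=.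
rewrite -[p.+1]addn1 -[(n + p)./2.+1]addn1 !natrD; by field.
Qed.

(** Here [n + p >= 2p + 1], so rounding up reaches [p + 1]; at [n = p + 1] rounding down would give
    only [p]. *)
Lemma uphalf_sub_ge1 (R : realType) (n p : nat) : (p < n)%N ->
  1 <= (uphalf (n + p))%:R - p%:R :> R.
Proof.
move=> lt_pn; rewrite lerBrDr addrC natr1 ler_nat.
by have := half_add_uphalf (n + p); have := uphalf_half (n + p); lia.
Qed.

Lemma Lambda_le (R : realType) (n p q : nat) : (p <= q <= n)%N ->
  Lambda R n p <= Lambda R n q.
Proof.
move=> /andP[/subnK <-]; elim: (q - p)%N => [//|k IHk] le_kn.
apply: le_trans (IHk (ltnW le_kn)) _; rewrite addSn -subr_ge0 Lambda_step.
exact: le_trans ler01 (uphalf_sub_ge1 R le_kn).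
Qed.

Lemma Lambda_full (R : realType) (n : nat) :
  Lambda R n n = n%:R * (n%:R + 1) / 2.
Proof.
rewrite LambdaE addnn doubleK uphalf_double; by field.
Qed.

Lemma Lambda_disjoint (R : realType) (n : nat) :
  Lambda R n 0 = n./2%:R * (uphalf n)%:R.
Proof. by rewrite LambdaE addn0 mul0r mul0r subr0. Qed.

(** With [h = n./2], both parities reduce the quotient to [(2h + 1) / h]; [n >= 2] keeps [h]
    nonzero. *)
Lemma Lambda_ratio (R : realType) (n : nat) : (2 <= n)%N ->
  Lambda R n n / Lambda R n 0 = 2 + 1 / n./2%:R.
Proof.
move=> n2; rewrite Lambda_full Lambda_disjoint.
have h0 : n./2%:R != 0 :> R by rewrite pnatr_eq0; lia.
have u0 : (uphalf n)%:R != 0 :> R by rewrite pnatr_eq0; lia.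
move: u0; rewrite uphalf_half natrD (natr_half _ n); case: odd => /= u0.
  by field; rewrite h0.
by field; rewrite h0.
Qed.

Lemma cvg_Lambda_ratio (R : realType) :
  (fun n : nat => Lambda R n n / Lambda R n 0) @ \oo --> (2 : R).
Proof.
have cvg_half : (fun n : nat => (n./2).-1) @ \oo --> \oo.
  apply/cvgnyPge => A; near=> n.
  have : (A.+1.*2 <= n)%N by near: n; exact: nbhs_infty_ge.
  by lia.
(* The harmonic sequence is [1/(k+1)], so [1/h] is its term at [k = h - 1]; this form agrees with
   the ratio once [n >= 2]. *)
have lim : (fun n => 2 + (n./2).-1.+1%:R^-1) @ \oo --> (2 : R).
  rewrite -[X in _ --> X]addr0; apply: cvgD; first exact: cvg_cst.
  exact: cvg_comp cvg_half cvg_harmonic.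
apply: cvg_trans lim; apply: near_eq_cvg.
near=> n; have n2 : (2 <= n)%N by near: n; exact: nbhs_infty_ge.
by rewrite Lambda_ratio //= div1r prednK //; lia.
Unshelve. all: by end_near. Qed.

Theorem proposition21 (R : realType) :
  (forall nU nb : nat, (2 <= nU)%N ->
    (forall alpha gamma p : nat, (alpha + gamma + p = nU)%N ->
       bonds_do_not_bind R nb (alpha + p) (gamma + p) p) ->
    (forall (D : finType) (T S : {set D}), #|T :|: S| = nU ->
       let p := #|T :&: S| in
       let alpha := (#|T| - p)%N in
       let gamma := (#|S| - p)%N in
       [/\ (alpha + gamma + p = nU)%N,
           rank_ceiling R nb #|T| #|S| p =
             #|T|%:R * #|S|%:R - p%:R * (p%:R - 1) / 2
         & rank_ceiling R nb #|T| #|S| p =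
             (alpha + p)%:R * (gamma + p)%:R - p%:R * (p%:R - 1) / 2]) /\
    (forall p : nat, (p <= nU)%N ->
       is_maximum
         [set c : R | exists alpha gamma : nat,
            (alpha + gamma = nU - p)%N /\
            c = rank_ceiling R nb (alpha + p) (gamma + p) p]
         (Lambda R nU p)) /\
    (forall p : nat, (p < nU)%N ->
       [/\ Lambda R nU p < Lambda R nU p.+1,
           Lambda R nU p.+1 - Lambda R nU p =
             (Num.ceil ((nU + p)%:R / 2 : R))%:~R - p%:R
         & 1 <= (Num.ceil ((nU + p)%:R / 2 : R))%:~R - p%:R :> R]) /\
    (forall p : nat, (p <= nU)%N -> Lambda R nU p <= Lambda R nU nU) /\
    [/\ Lambda R nU nU = nU%:R * (nU%:R + 1) / 2,
        Lambda R nU 0 =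
          (Num.floor (nU%:R / 2 : R))%:~R * (Num.ceil (nU%:R / 2 : R))%:~R,
        Lambda R nU nU / Lambda R nU 0 =
          2 + 1 / (Num.floor (nU%:R / 2 : R))%:~R
      & 2 < Lambda R nU nU / Lambda R nU 0]) /\
  (fun n : nat => Lambda R n n / Lambda R n 0) @ \oo --> (2 : R).
Proof.
split; last exact: cvg_Lambda_ratio.
move=> n nb n2 nbP; split; [|split; [|split; [|split]]].
- move=> D T S cTS p a g.
  (* Inclusion-exclusion yields [a + g + p = n]; the bounds of [p] by [#|T|] and [#|S|] make the
     natural subtractions exact. *)
  have UI := cardsUI T S.
  have pT : (p <= #|T|)%N by rewrite subset_leq_card // subsetIl.
  have pS : (p <= #|S|)%N by rewrite subset_leq_card // subsetIr.
  have agp : (a + g + p = n)%N by rewrite /a /g /p in pT pS *; lia.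
  have := rank_ceiling_unbound (nbP _ _ _ agp).
  by rewrite !subnK.
- by move=> p le_pn; apply: Lambda_is_maximum => // a g; exact: nbP.
- move=> p lt_pn; rewrite ceil_half -pmulrn.
  have step_ge1 := uphalf_sub_ge1 R lt_pn.
  split; [|exact: Lambda_step|exact: step_ge1].
  by rewrite -subr_gt0 Lambda_step; exact: lt_le_trans ltr01 step_ge1.
- by move=> p le_pn; rewrite Lambda_le // le_pn /=.
- rewrite floor_half ceil_half -!pmulrn Lambda_ratio //.
  split=> //; [exact: Lambda_full | exact: Lambda_disjoint |].
  by rewrite ltrDl divr_gt0 // ltr0n; lia.
Qed.
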